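(* Let $f:\mathbb R^n\to(-\infty,+\infty]$ and $g:\mathbb R^m\to(-\infty,+\infty]$ be proper lower semicontinuous convex functions, let $A\in\mathbb R^{m\times n}$, and put $\mathcal L(x,y)=f(x)+\langle Ax,y\rangle-g(y)$. Let $z_*$ be any optimal solution of $\min_{x\in\mathbb R^n}\max_{y\in\mathbb R^m}\mathcal L(x,y)$. Let $0<s<\frac1{\|A\|}$ and let $z_k=(x_k,y_k)$, $k\ge0$, be the iterates of PDHG with step-size $s$ started at an arbitrary point $z_0\in\mathbb R^n\times\mathbb R^m$. Then for every $k\ge1$ and every $z=(x,y)\in\mathrm{dom} f\times\mathrm{dom} g$, $$\mathcal L(x_k,y)-\mathcal L(x,y_k)\le\frac1{\sqrt k}\Bigl(\|z_0-z_*\|_{P_s}^2+\|z_0-z_*\|_{P_s}\,\|z_*-z\|_{P_s}\Bigr).$$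
   Context: $\|A\|$ is the operator (spectral) norm, with $1/\|A\|=+\infty$ if $A=0$. $\mathrm{dom} f=\{x: f(x)<+\infty\}$, and similarly for $g$. For $\tau>0$ and convex $h$, $\mathrm{prox}_h^{\tau}(x)=\mathrm{argmin}_{u}\{h(u)+\frac1{2\tau}\|u-x\|_2^2\}$. PDHG (primal-dual hybrid gradient) with step-size $s>0$ is the iteration $$x_{k+1}=\mathrm{prox}_f^{s}(x_k-sA^Ty_k),\qquad y_{k+1}=\mathrm{prox}_g^{s}(y_k+sA(2x_{k+1}-x_k)).$$ An optimal solution of the minimax problem is a point $z=(x,y)$ with $0\in\mathcal F(z)=\begin{pmatrix}\partial f(x)+A^Ty\\ -Ax+\partial g(y)\end{pmatrix}$ (equivalently, a saddle point of $\mathcal L$), where $\partial$ is the convex subdifferential. $P_s=\begin{pmatrix}\frac1sI_n&-A^T\\-A&\frac1sI_m\end{pmatrix}$, which is positive definite for $0<s<1/\|A\|$, and $\|u\|_{P_s}=\sqrt{u^TP_su}$. *)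

(* Defs.v *)
From HB Require Import structures.
From mathcomp Require Import all_boot all_order all_algebra.
From mathcomp Require Import all_classical all_reals all_analysis.

Set Implicit Arguments.
Unset Strict Implicit.
Unset Printing Implicit Defensive.
Import Order.TTheory GRing.Theory Num.Theory.
Import numFieldNormedType.Exports.

Local Open Scope classical_set_scope.
Local Open Scope ring_scope.

Section Euclidean.
Context {R : realType}.

Definition inner {n : nat} (u v : 'cV[R]_n) : R := (u^T *m v) 0 0.

(* The Euclidean norm; the norm `|u| of the library on matrices is the
   maximum norm. *)
Definition norm2 {n : nat} (u : 'cV[R]_n) : R := Num.sqrt (inner u u).

(* Extended real-valued, so that its inverse in \bar R is +oo when A = 0. *)
Definition opnorm {m n : nat} (A : 'M[R]_(m, n)) : \bar R :=
  ereal_sup [set (norm2 (A *m x))%:E | x in [set x : 'cV[R]_n | norm2 x <= 1]].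

End Euclidean.

Section ConvexAnalysis.
Context {R : realType} {n : nat}.
Implicit Types (f : 'cV[R]_n -> \bar R).

Definition edom f : set 'cV[R]_n := [set x | (f x < +oo)%E].

Definition proper_function f : Prop :=
  (forall x, (-oo < f x)%E) /\ edom f !=set0.

(* At t = 0 and t = 1 this relies on the convention 0 * +oo = 0. *)
Definition econvex f : Prop :=
  forall (x y : 'cV[R]_n) (t : R), 0 <= t <= 1 ->
    (f (t *: x + (1 - t) *: y)%R <= t%:E * f x + (1 - t)%:E * f y)%E.

Definition subdifferential f (x : 'cV[R]_n) : set 'cV[R]_n :=
  [set p | forall u, (f x + (inner p (u - x))%:E <= f u)%E].

Definition argmin f : set 'cV[R]_n := [set u | forall v, (f u <= f v)%E].

(* Set-valued: no existence or uniqueness of the minimizer is built in. *)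
Definition prox (tau : R) f (x : 'cV[R]_n) : set 'cV[R]_n :=
  argmin (fun u => (f u + ((2 * tau)^-1 * norm2 (u - x) ^+ 2)%:E)%E).

End ConvexAnalysis.

Section PDHG.
Context {R : realType} {n m : nat}.
Variables (f : 'cV[R]_n -> \bar R) (g : 'cV[R]_m -> \bar R) (A : 'M[R]_(m, n)).

Definition lagrangian (x : 'cV[R]_n) (y : 'cV[R]_m) : \bar R :=
  (f x + (inner (A *m x) y)%:E - g y)%E.

Definition saddle_op (z : 'cV[R]_n * 'cV[R]_m) : set ('cV[R]_n * 'cV[R]_m) :=
  [set (p + A^T *m z.2, - (A *m z.1) + q)
    | p in subdifferential f z.1 & q in subdifferential g z.2].

Definition optimal_solution (z : 'cV[R]_n * 'cV[R]_m) : Prop :=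
  saddle_op z (0, 0).

Definition pdhg_iterates (s : R) (z : nat -> 'cV[R]_n * 'cV[R]_m) : Prop :=
  forall k : nat,
    prox s f ((z k).1 - s *: (A^T *m (z k).2)) (z k.+1).1 /\
    prox s g ((z k).2 + s *: (A *m (2 *: (z k.+1).1 - (z k).1))) (z k.+1).2.

Definition Pmx (s : R) : 'M[R]_(n + m) :=
  block_mx (s^-1)%:M (- A^T) (- A) (s^-1)%:M.

Definition Pnorm (s : R) (z : 'cV[R]_n * 'cV[R]_m) : R :=
  let u := col_mx z.1 z.2 in Num.sqrt ((u^T *m Pmx s *m u) 0 0).

End PDHG.

(* Main.v *)
(* PDHG is the proximal point iteration for the monotone operator
   [saddle_op] in the semi-inner product of [Pmx]: the optimality conditions
   of the two proximal steps say P (z_k - z_(k+1)) \in F (z_(k+1)). Hence the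
   distance to a solution decreases with
     |z_(k+1) - z*|^2 + |z_k - z_(k+1)|^2 <= |z_k - z*|^2,
   and |z_k - z_(k+1)| is nonincreasing, so that
   |z_(k-1) - z_k| <= |z_0 - z*| / sqrt k. Since any w \in F (z_k) bounds the
   gap at z by <w, z_k - z>, Cauchy-Schwarz gives the rate for the last
   iterate. *)

Require Import Defs.
From mathcomp Require Import all_boot all_order all_algebra.
From mathcomp Require Import all_classical all_reals all_analysis.
From mathcomp Require Import ring lra.
Import Order.TTheory GRing.Theory Num.Theory.
Import numFieldNormedType.Exports.
Local Open Scope classical_set_scope.
Local Open Scope ring_scope.

(** * Semi-inner products and the proximal point iteration *)

Definition semi_inner_product {R : realType} {V : lmodType R}
    (B : V -> V -> R) : Prop :=
  [/\ forall u v, B u v = B v u,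
      forall u v w, B (u + v) w = B u w + B v w,
      forall a u v, B (a *: u) v = a * B u v
    & forall u, 0 <= B u u].

Definition semi_norm {R : realType} {V : lmodType R} (B : V -> V -> R) (u : V)
  : R := Num.sqrt (B u u).

(** Discriminant argument: the quadratic form of [B] on the span of [u] and [v] is nonnegative, and
    a negative determinant is refuted by one explicit point. *)
Lemma semi_inner_cauchy_schwarz {R : realType} {V : lmodType R}
    {B : V -> V -> R} (u v : V) : semi_inner_product B ->
  B u v <= semi_norm B u * semi_norm B v.
Proof.
move=> [BC BD BZ B_ge0].
have quad p q :
    0 <= p * p * B u u + 2 * p * q * B u v + q * q * B v v.
  have := B_ge0 (p *: u + q *: v).
  rewrite !BD ![B _ (_ + _)]BC !BD !BZ ![B _ (_ *: _)]BC !BZ (BC v u).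
  by congr (0 <= _); ring.
have a0 := B_ge0 u; have c0 := B_ge0 v.
suff sqr_le : B u v ^+ 2 <= B u u * B v v.
  rewrite /semi_norm -sqrtrM //; apply: le_trans (ler_norm _) _.
  by rewrite -sqrtr_sqr ler_wsqrtr.
move: (B u u) (B u v) (B v v) a0 c0 quad => a b c a0 c0 quad.
rewrite leNgt; apply/negP => lt_ac.
have [a_gt0|a_le0] := ltP 0 a.
  (* At (-b, a) the form equals a (a c - b^2), which is negative here. *)
  by have := quad (- b) a; nra.
(* In the degenerate case b^2 > 0, and the form at (-(c + 1), b) equals -(c + 2) b^2. *)
have a_eq0 : a = 0 by lra.
have := quad (- (c + 1)) b; rewrite a_eq0 in lt_ac *; nra.
Qed.

(* [h_fejer] and [h_resid] are the monotonicity of the operator between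
   [Z k.+1] and a zero, and between two consecutive iterates. *)
Lemma proximal_point_rate {R : realType} {V : lmodType R}
    {B : V -> V -> R} (Z : nat -> V) (zs w : V) (k : nat) :
  semi_inner_product B ->
  (forall i, 0 <= B (Z i - Z i.+1) (Z i.+1 - zs)) ->
  (forall i, 0 <= B ((Z i - Z i.+1) - (Z i.+1 - Z i.+2)) (Z i.+1 - Z i.+2)) ->
  B (Z k - Z k.+1) (Z k.+1 - w) <=
    (Num.sqrt k.+1%:R)^-1 *
    (semi_norm B (Z 0%N - zs) ^+ 2 +
     semi_norm B (Z 0%N - zs) * semi_norm B (zs - w)).
Proof.
move=> hB h_fejer h_resid; set N := semi_norm B.
have [BC BD BZ B_ge0] := hB.
have BDr u v t : B t (u + v) = B t u + B t v by rewrite BC BD !(BC t).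
have BN u v : B (- u) v = - B u v by rewrite -scaleN1r BZ mulN1r.
have N_ge0 u : 0 <= N u by apply: sqrtr_ge0.
pose D i := B (Z i - Z i.+1) (Z i - Z i.+1).
pose E i := B (Z i - zs) (Z i - zs).
have fejer i : E i.+1 + D i <= E i.
  (* Expand the square of (Z i - Z i.+1) + (Z i.+1 - zs); the cross term is the one in [h_fejer]. *)
  have -> : E i = E i.+1 + D i + 2 * B (Z i - Z i.+1) (Z i.+1 - zs).
    rewrite /E /D -[Z i - zs](subrKA (Z i.+1)).
    move: (Z i - _) (Z i.+1 - _) => a b.
    by rewrite BD !BDr (BC b a); ring.
  by have := h_fejer i; lra.
(* For consecutive residuals a and b, B a a - B b b = B (a - b) (a - b) + 2 B (a - b) b. *)
have D_nincr i : D i.+1 <= D i.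
  have := h_resid i; have := B_ge0 ((Z i - Z i.+1) - (Z i.+1 - Z i.+2)).
  rewrite /D; move: (Z i - Z i.+1) (Z i.+1 - Z i.+2) => a b.
  rewrite !BD !BDr !BN ![B _ (- b)]BC !BN (BC b a); lra.
(* Telescoping [fejer] bounds the sum of all D j with j <= i, and each of these is at least D i. *)
have sum_le i : E i.+1 + i.+1%:R * D i <= E 0%N.
  elim: i => [|i IHi]; first by rewrite mul1r fejer.
  have := fejer i.+1; have := D_nincr i.
  have : 0 <= i.+1%:R :> R by [].
  rewrite -[i.+2%:R]natr1; move: (i.+1%:R : R) IHi => c; nra.
have k1_gt0 : 0 < k.+1%:R :> R by [].
have D_ge0 : 0 <= D k by apply: B_ge0.
have N_resid : N (Z k - Z k.+1) <= (Num.sqrt k.+1%:R)^-1 * N (Z 0%N - zs).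
  rewrite ler_pdivlMl ?sqrtr_gt0// -sqrtrM //; apply: ler_wsqrtr.
  have := sum_le k; have := B_ge0 (Z k.+1 - zs); rewrite /E /D; lra.
have N_dist : N (Z k.+1 - zs) <= N (Z 0%N - zs).
  apply: ler_wsqrtr; have := sum_le k; rewrite /E.
  have : 0 <= k.+1%:R * D k by rewrite mulr_ge0.
  lra.
(* Splitting at [zs] produces the two terms of the bound; [N_resid] supplies the factor 1 / sqrt (k
   + 1) for both. *)
rewrite -[Z k.+1 - w](subrKA zs) BDr.
have := semi_inner_cauchy_schwarz (Z k - Z k.+1) (Z k.+1 - zs) hB.
have := semi_inner_cauchy_schwarz (Z k - Z k.+1) (zs - w) hB.
rewrite -/N => le1 le2; apply: le_trans (lerD le2 le1) _.
rewrite -mulrDr expr2 -mulrDr mulrA.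
by apply: ler_pM; rewrite ?addr_ge0 ?lerD2r.
Qed.

(** * The Euclidean inner product and the form of [Pmx] *)

Lemma innerE {R : realType} {n : nat} (u v : 'cV[R]_n) :
  inner u v = \sum_i u i 0 * v i 0.
Proof. by rewrite /inner mxE; apply: eq_bigr => i _; rewrite mxE. Qed.

Lemma innerC {R : realType} {n : nat} (u v : 'cV[R]_n) : inner u v = inner v u.
Proof. by rewrite !innerE; apply: eq_bigr => i _; rewrite mulrC. Qed.

Lemma innerDl {R : realType} {n : nat} (u v w : 'cV[R]_n) :
  inner (u + v) w = inner u w + inner v w.
Proof. by rewrite /inner linearD mulmxDl mxE. Qed.

Lemma innerDr {R : realType} {n : nat} (u v w : 'cV[R]_n) :
  inner w (u + v) = inner w u + inner w v.
Proof. by rewrite innerC innerDl !(innerC w). Qed.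

Lemma innerZl {R : realType} {n : nat} a (u v : 'cV[R]_n) :
  inner (a *: u) v = a * inner u v.
Proof. by rewrite /inner linearZ -scalemxAl mxE. Qed.

Lemma innerZr {R : realType} {n : nat} a (u v : 'cV[R]_n) :
  inner v (a *: u) = a * inner v u.
Proof. by rewrite innerC innerZl innerC. Qed.

Lemma inner0l {R : realType} {n : nat} (v : 'cV[R]_n) : inner 0 v = 0.
Proof. by rewrite /inner trmx0 mul0mx mxE. Qed.

Lemma innerNl {R : realType} {n : nat} (u v : 'cV[R]_n) :
  inner (- u) v = - inner u v.
Proof. by rewrite -scaleN1r innerZl mulN1r. Qed.

Lemma innerNr {R : realType} {n : nat} (u v : 'cV[R]_n) :
  inner v (- u) = - inner v u.
Proof. by rewrite innerC innerNl innerC. Qed.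

Lemma inner_ge0 {R : realType} {n : nat} (u : 'cV[R]_n) : 0 <= inner u u.
Proof. by rewrite innerE sumr_ge0 // => i _; rewrite -expr2 sqr_ge0. Qed.

Lemma inner_eq0 {R : realType} {n : nat} (u : 'cV[R]_n) :
  inner u u = 0 -> u = 0.
Proof.
rewrite innerE => /eqP; rewrite psumr_eq0 => [/allP u0|i _]; last first.
  by rewrite -expr2 sqr_ge0.
apply/colP => i; rewrite mxE; apply/eqP.
by have := u0 i (mem_index_enum i); rewrite mulf_eq0 orbb.
Qed.

Lemma inner_trmx {R : realType} {m n : nat} (A : 'M[R]_(m, n)) x y :
  inner (A^T *m y) x = inner (A *m x) y.
Proof. by rewrite [RHS]innerC /inner trmx_mul trmxK mulmxA. Qed.

Lemma inner_col_mx {R : realType} {m n : nat} (a c : 'cV[R]_m) (b d : 'cV[R]_n) :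
  inner (col_mx a b) (col_mx c d) = inner a c + inner b d.
Proof. by rewrite /inner tr_col_mx mul_row_col mxE. Qed.

Lemma norm2_sqr {R : realType} {n : nat} (u : 'cV[R]_n) :
  norm2 u ^+ 2 = inner u u.
Proof. by rewrite /norm2 sqr_sqrtr // inner_ge0. Qed.

Lemma opnorm_ge0 {R : realType} {m n : nat} (A : 'M[R]_(m, n)) :
  (0 <= opnorm A)%E.
Proof.
apply: ereal_sup_ubound; exists 0 => /=;
  by rewrite ?mulmx0 /norm2 inner0l sqrtr0.
Qed.

(** The supremum defining [opnorm A] is tested at x / |x|. Inverting the hypothesis in [\bar R] to
    [opnorm A] < 1 / s also covers A = 0. *)
Lemma inner_mulmx_le_opnorm {R : realType} {m n : nat} (A : 'M[R]_(m, n))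
    (s : R) (x : 'cV[R]_n) : 0 < s -> (s%:E < (opnorm A)^-1)%E ->
  s ^+ 2 * inner (A *m x) (A *m x) <= inner x x.
Proof.
move=> s0; rewrite inve_pgt ?inE ?lee_fin ?(ltW s0) ?opnorm_ge0 //.
rewrite inver gt_eqF // => opn_lt.
have [x0|x0] := eqVneq (inner x x) 0.
  by rewrite (inner_eq0 _ x0) mulmx0 !inner0l mulr0.
have x_gt0 : 0 < inner x x by rewrite lt_neqAle eq_sym x0 inner_ge0.
have nx_gt0 : 0 < norm2 x by rewrite sqrtr_gt0.
pose y := (norm2 x)^-1 *: x.
have inner_y u : inner ((norm2 x)^-1 *: u) ((norm2 x)^-1 *: u)
    = inner u u / inner x x.
  by rewrite innerZl innerZr -(norm2_sqr x) mulrA -expr2 exprVn mulrC.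
have Ay_le : ((norm2 (A *m y))%:E <= opnorm A)%E.
  apply: ereal_sup_ubound; exists y => //=.
  by rewrite /norm2 inner_y divff // sqrtr1.
have {Ay_le} := le_lt_trans Ay_le opn_lt; rewrite lte_fin => Ay_lt.
have : inner (A *m y) (A *m y) <= (s^-1) ^+ 2.
  by rewrite -norm2_sqr ler_sqr ?nnegrE ?sqrtr_ge0 ?invr_ge0 // ltW.
rewrite /y -scalemxAr inner_y ler_pdivrMr // exprVn mulrC.
by rewrite ler_pdivlMr ?exprn_gt0 // mulrC.
Qed.

(** The bilinear form u^T P v of [Pmx], with the transpose moved across the inner product. *)
Definition Pform {R : realType} {n m : nat} (A : 'M[R]_(m, n)) (s : R)
    (u v : 'cV[R]_n * 'cV[R]_m) : R :=
  s^-1 * (inner u.1 v.1 + inner u.2 v.2)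
  - inner (A *m u.1) v.2 - inner (A *m v.1) u.2.

Lemma PnormE {R : realType} {n m : nat} (A : 'M[R]_(m, n)) (s : R) u :
  Pnorm A s u = semi_norm (Pform A s) u.
Proof.
rewrite /Pnorm /semi_norm; congr Num.sqrt.
rewrite -mulmxA -/(inner _ _) /Pmx mul_block_col inner_col_mx.
rewrite !mul_scalar_mx !mulNmx !(innerDr, innerNr, innerZr).
rewrite [inner u.1 (_ *m _)]innerC inner_trmx [inner u.2 (A *m _)]innerC.
by rewrite /Pform; ring.
Qed.

Lemma Pform_semi_inner {R : realType} {n m : nat} (A : 'M[R]_(m, n)) (s : R) :
  0 < s -> (s%:E < (opnorm A)^-1)%E -> semi_inner_product (Pform A s).
Proof.
move=> s0 s_lt; split.
- by move=> u v; rewrite /Pform (innerC u.1) (innerC u.2); ring.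
- move=> [u u'] [v v'] [w w'].
  by rewrite /Pform /= mulmxDr !(innerDl, innerDr); ring.
- move=> a [u u'] [v v'].
  by rewrite /Pform /= -scalemxAr !(innerZl, innerZr); ring.
- move=> [x y]; rewrite /Pform /=.
  have Ax_le := inner_mulmx_le_opnorm A s x s0 s_lt.
  (* Completing the square in [y - s A x]. *)
  have := inner_ge0 (y - s *: (A *m x)).
  rewrite !(innerDl, innerDr, innerNl, innerNr, innerZl, innerZr).
  rewrite (innerC y (A *m x)) => sq_ge0.
  (* Multiplied by s, the form is |y - s A x|^2 + |x|^2 - s^2 |A x|^2. *)
  rewrite -(pmulr_rge0 _ s0) !mulrBr mulVKf ?gt_eqF //.
  by nra.
Qed.

(** * Subgradients and the PDHG step *)

Lemma subdifferential_fin_num {R : realType} {n : nat} (f : 'cV[R]_n -> \bar R)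
    x p : proper_function f -> subdifferential f x p -> f x \is a fin_num.
Proof.
move=> [f_gtNy [u fu_lt]] /(_ u) fx_le; rewrite fin_numElt f_gtNy /=.
have : (f x + (inner p (u - x))%:E < +oo)%E by apply: le_lt_trans fx_le _.
by case: (f x) => [r _| |] //; rewrite ltry.
Qed.

Lemma edom_fin_num {R : realType} {n : nat} (f : 'cV[R]_n -> \bar R) x :
  proper_function f -> edom f x -> f x \is a fin_num.
Proof. by move=> [f_gtNy _] fx; rewrite fin_numElt f_gtNy. Qed.

Lemma fine_subgradient_le {R : realType} {n : nat} (f : 'cV[R]_n -> \bar R)
    x p u : proper_function f -> subdifferential f x p -> edom f u ->
  fine (f x) + inner p (u - x) <= fine (f u).
Proof.
move=> f_proper fp fu; rewrite -lee_fin EFinD !fineK //.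
- exact: edom_fin_num.
- exact: subdifferential_fin_num f_proper fp.
Qed.

(** Fermat's rule for the proximal objective: compare [u] with points of the segment towards [v].
    One well-chosen t replaces the limit t -> 0. *)
Lemma prox_subgradient {R : realType} {n : nat} (f : 'cV[R]_n -> \bar R)
    (tau : R) (a u : 'cV[R]_n) :
  proper_function f -> econvex f -> 0 < tau -> prox tau f a u ->
  subdifferential f u (tau^-1 *: (a - u)).
Proof.
move=> f_proper f_convex tau0 u_prox v.
have [fv|fv] := eqVneq (f v) +oo%E; first by rewrite fv leey.
have fv_fin : f v \is a fin_num.
  by apply: edom_fin_num => //; rewrite /edom /= ltey.
have fu_fin : f u \is a fin_num.
  have [f_gtNy _] := f_proper; rewrite fin_numElt f_gtNy /=.
  by have := u_prox v; rewrite -(fineK fv_fin); case: (f u) (f_gtNy u).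
move: fv_fin fu_fin => /fineK fvE /fineK fuE.
move: (fine (f v)) (fine (f u)) fvE fuE => rv ru /esym fvE /esym fuE.
rewrite fvE fuE -EFinD lee_fin innerZl.
set c := (2 * tau)^-1; have c0 : 0 < c by rewrite invr_gt0; lra.
have -> : tau^-1 = 2 * c by rewrite /c invfM; field; rewrite gt_eqF.
(* Minimality at t v + (1 - t) u combined with convexity of [f], then divided by t. *)
have step t : 0 < t <= 1 ->
    ru <= rv + c * (t * inner (v - u) (v - u) - 2 * inner (a - u) (v - u)).
  move=> /andP[t0 t1].
  have t01 : 0 <= t <= 1 by rewrite ltW.
  have := le_trans (u_prox _) (leeD2r _ (f_convex v u t t01)).
  rewrite fvE fuE -!EFinM -!EFinD lee_fin -/c.
  have -> : t *: v + (1 - t) *: u - a = t *: (v - u) - (a - u).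
    by apply/colP => i; rewrite !mxE; ring.
  have -> : u - a = - (a - u) by rewrite opprB.
  rewrite !norm2_sqr; move: (v - u) (a - u) => d w.
  rewrite !(innerDl, innerDr, innerNl, innerNr, innerZl, innerZr) (innerC d w).
  by move=> le_t; rewrite -(ler_pM2l t0); lra.
rewrite leNgt; apply/negP => lt_e.
have D0 := inner_ge0 (v - u).
move: (inner (v - u) (v - u)) (inner (a - u) (v - u)) step lt_e D0.
move=> D W step lt_e D0.
(* [step] reads e <= t c D. For t = e / (e + c D), which lies in (0, 1] even if D = 0, one has t c D
   = (1 - t) e < e. *)
pose e := ru + 2 * c * W - rv.
have e0 : 0 < e by rewrite /e; lra.
have cD : 0 <= c * D by rewrite mulr_ge0 // ltW.
have eD : 0 < e + c * D by lra.
have := step (e / (e + c * D)).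
rewrite divr_gt0 // ler_pdivrMr // mul1r lerDl cD => /(_ isT).
have : e / (e + c * D) * (e + c * D) = e by rewrite divfK // gt_eqF.
have t0 : 0 < e / (e + c * D) by rewrite divr_gt0.
by move: (e / _) t0 => t t0 te; rewrite /e in e0 te; nra.
Qed.

(** A real-valued difference of Lagrangians, meaningful on the domains. Its antisymmetry turns a gap
    bound used in both directions into monotonicity of [saddle_op]. *)
Definition gap {R : realType} {n m : nat} (f : 'cV[R]_n -> \bar R)
    (g : 'cV[R]_m -> \bar R) (A : 'M[R]_(m, n))
    (z z' : 'cV[R]_n * 'cV[R]_m) : R :=
  (fine (f z.1) + inner (A *m z.1) z'.2 - fine (g z'.2))
  - (fine (f z'.1) + inner (A *m z'.1) z.2 - fine (g z.2)).

Lemma gapN {R : realType} {n m : nat} (f : 'cV[R]_n -> \bar R)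
    (g : 'cV[R]_m -> \bar R) (A : 'M[R]_(m, n)) z z' :
  gap f g A z' z = - gap f g A z z'.
Proof. by rewrite /gap; ring. Qed.

Lemma lagrangian_subE {R : realType} {n m : nat} (f : 'cV[R]_n -> \bar R)
    (g : 'cV[R]_m -> \bar R) (A : 'M[R]_(m, n)) z z' :
  proper_function f -> proper_function g ->
  (edom f `*` edom g) z -> (edom f `*` edom g) z' ->
  (lagrangian f g A z.1 z'.2 - lagrangian f g A z'.1 z.2)%E =
  (gap f g A z z')%:E.
Proof.
move=> f_proper g_proper [/= fz gz] [/= fz' gz'].
rewrite /lagrangian /gap !(EFinB, EFinD) !fineK //; exact: edom_fin_num.
Qed.

Lemma saddle_op_edom {R : realType} {n m : nat} (f : 'cV[R]_n -> \bar R)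
    (g : 'cV[R]_m -> \bar R) (A : 'M[R]_(m, n)) z w :
  proper_function f -> proper_function g -> saddle_op f g A z w ->
  (edom f `*` edom g) z.
Proof.
move=> f_proper g_proper [p fp [q gq _]]; split; rewrite /edom /=.
- by rewrite ltey_eq (subdifferential_fin_num _ _ _ f_proper fp).
- by rewrite ltey_eq (subdifferential_fin_num _ _ _ g_proper gq).
Qed.

(** Sum of the two subgradient inequalities; the coupling contributes equally to both sides because
    its linear operator is skew. *)
Lemma saddle_op_gap_le {R : realType} {n m : nat} (f : 'cV[R]_n -> \bar R)
    (g : 'cV[R]_m -> \bar R) (A : 'M[R]_(m, n)) z w z' :
  proper_function f -> proper_function g -> saddle_op f g A z w ->
  (edom f `*` edom g) z' ->
  gap f g A z z' <= inner w.1 (z - z').1 + inner w.2 (z - z').2.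
Proof.
move=> f_proper g_proper [p fp [q gq <-]] [/= fz' gz'].
have := fine_subgradient_le _ _ _ _ f_proper fp fz'.
have := fine_subgradient_le _ _ _ _ g_proper gq gz'.
rewrite /gap !(innerDl, innerDr, innerNl, innerNr) !inner_trmx.
lra.
Qed.

(** The pair is [Pmx] applied to [d]. The extrapolation 2 x_(k+1) - x_k is what makes the second
    component - A d.1, hence P symmetric. *)
Lemma pdhg_saddle_op {R : realType} {n m : nat} (f : 'cV[R]_n -> \bar R)
    (g : 'cV[R]_m -> \bar R) (A : 'M[R]_(m, n)) (s : R) z_ k :
  proper_function f -> econvex f -> proper_function g -> econvex g ->
  0 < s -> pdhg_iterates f g A s z_ ->
  let d := z_ k - z_ k.+1 in
  saddle_op f g A (z_ k.+1)
    (s^-1 *: d.1 - A^T *m d.2, s^-1 *: d.2 - A *m d.1).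
Proof.
move=> f_proper f_convex g_proper g_convex s0 /(_ k) [fz gz] d.
have s_neq0 : s != 0 by rewrite gt_eqF.
eexists; first exact: prox_subgradient fz.
eexists; first exact: prox_subgradient gz.
rewrite /d /= !mulmxBr -scalemxAr; congr pair.
- move: (A^T *m _) (A^T *m _) => u v.
  by apply/colP => i; rewrite !mxE; field.
- move: (A *m _) (A *m _) => u v.
  by apply/colP => i; rewrite !mxE; field.
Qed.

Lemma Pform_inner {R : realType} {n m : nat} (A : 'M[R]_(m, n)) (s : R) d e :
  inner (s^-1 *: d.1 - A^T *m d.2) e.1 + inner (s^-1 *: d.2 - A *m d.1) e.2 =
  Pform A s d e.
Proof.
by rewrite /Pform !(innerDl, innerNl, innerZl) inner_trmx; ring.
Qed.

Theorem corollary1 (R : realType) (n m : nat)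
  (f : 'cV[R]_n -> \bar R) (g : 'cV[R]_m -> \bar R) (A : 'M[R]_(m, n))
  (f_proper : proper_function f) (f_lsc : lower_semicontinuous f)
  (f_convex : econvex f)
  (g_proper : proper_function g) (g_lsc : lower_semicontinuous g)
  (g_convex : econvex g)
  (zstar : 'cV[R]_n * 'cV[R]_m) (zstar_opt : optimal_solution f g A zstar)
  (s : R) (s_gt0 : 0 < s) (s_lt : (s%:E < (opnorm A)^-1)%E)
  (z_ : nat -> 'cV[R]_n * 'cV[R]_m) (z_pdhg : pdhg_iterates f g A s z_)
  (k : nat) (k_ge1 : (1 <= k)%N)
  (z : 'cV[R]_n * 'cV[R]_m) (z_dom : (edom f `*` edom g) z) :
  (lagrangian f g A (z_ k).1 z.2 - lagrangian f g A z.1 (z_ k).2 <=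
   ((Num.sqrt k%:R)^-1 *
    (Pnorm A s (z_ 0%N - zstar) ^+ 2 +
     Pnorm A s (z_ 0%N - zstar) * Pnorm A s (zstar - z)))%:E)%E.
Proof.
have step i := pdhg_saddle_op f g A s z_ i
  f_proper f_convex g_proper g_convex s_gt0 z_pdhg.
(* The starting point is arbitrary, so domain membership begins at index 1. *)
have z_edom i : (edom f `*` edom g) (z_ i.+1).
  exact: saddle_op_edom f_proper g_proper (step i).
have gap_le i z' : (edom f `*` edom g) z' ->
    gap f g A (z_ i.+1) z' <= Pform A s (z_ i - z_ i.+1) (z_ i.+1 - z').
  rewrite -Pform_inner; exact: saddle_op_gap_le (step i).
case: k k_ge1 => [//|k] _.
rewrite lagrangian_subE // lee_fin !PnormE.
apply: le_trans (gap_le _ _ z_dom) _.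
have B_inner := Pform_semi_inner A s s_gt0 s_lt.
have [BC BD BZ _] := B_inner.
have BN u v : Pform A s (- u) v = - Pform A s u v.
  by rewrite -scaleN1r BZ mulN1r.
apply: proximal_point_rate => // i.
(* The zero element of [saddle_op] at [zstar] makes the gap from any later iterate to [zstar]
   nonnegative. *)
- have zs_edom := saddle_op_edom _ _ _ _ _ f_proper g_proper zstar_opt.
  apply: le_trans (gap_le _ _ zs_edom).
  have := saddle_op_gap_le _ _ _ _ _ _ f_proper g_proper zstar_opt (z_edom i).
  by rewrite gapN /= !inner0l addr0 oppr_le0.
(* Add [gap_le] between [z_ i.+1] and [z_ i.+2] in both directions; the gaps cancel. *)
- rewrite BD BN.
  have := gap_le i _ (z_edom i.+1); have := gap_le i.+1 _ (z_edom i).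
  rewrite gapN -[z_ i.+2 - z_ i.+1]opprB BC BN BC.
  lra.
Qed.
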